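(* A non singular 2-step nilpotent Lie algebra does not admit an ad-invariant metric. In particular, 2-step nilpotent Lie algebras of H-type cannot be equipped with an ad-invariant metric.
   Context: All Lie algebras are real and finite dimensional. A metric is a non-degenerate symmetric bilinear form (of any signature); a metric on a Lie algebra $\mathfrak g$ is ad-invariant if $\langle [x,y],z\rangle+\langle y,[x,z]\rangle=0$ for all $x,y,z\in\mathfrak g$. $\mathfrak n$ is 2-step nilpotent if $[\mathfrak n,[\mathfrak n,\mathfrak n]]=0$ and $[\mathfrak n,\mathfrak n]\neq0$; $\mathfrak z$ denotes its center. A 2-step nilpotent Lie algebra $\mathfrak n$ is non singular if $\operatorname{ad}_x:\mathfrak n\to\mathfrak z$ is surjective for every $x\in\mathfrak n\setminus\mathfrak z$. Given an inner product $(\,,\,)$ on $\mathfrak n$ and $\mathfrak v=\mathfrak z^\perp$, each $z\in\mathfrak z$ defines a skew-symmetric map $J_z:\mathfrak v\to\mathfrak v$ by $(J_zu,v)=(z,[u,v])$ for $u,v\in\mathfrak v$. A 2-step nilpotent Lie algebra with inner product $(\,,\,)$ is of H-type if $J_z^2=-(z,z)\,\mathrm{Id}_{\mathfrak v}$ for all $z\in\mathfrak z$. *)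

(* Defs.v *)
From HB Require Import structures.
From mathcomp Require Import all_boot all_order all_algebra.
From mathcomp Require Import reals.

Set Implicit Arguments.
Unset Strict Implicit.
Unset Printing Implicit Defensive.

Import Order.TTheory GRing.Theory Num.Theory.
Local Open Scope ring_scope.

HB.mixin Record isLieAlgebra (K : fieldType) g of Vector K g := {
  lie : g -> g -> g;
  lie_bilinear : bilinear_for *:%R *:%R lie;
  lie_alternating : forall x, lie x x = 0;
  lie_jacobi : forall x y z,
    lie x (lie y z) + lie y (lie z x) + lie z (lie x y) = 0
}.

#[short(type="lieAlgType")]
HB.structure Definition LieAlgebra (K : fieldType) :=
  {g of isLieAlgebra K g & Vector K g}.

Notation "[lie x , y ]" := (lie x y)
  (at level 0, x at level 99, y at level 99, format "[lie  x ,  y ]")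
  : ring_scope.

Section LieAlgebraTheory.
Variables (K : fieldType) (g : lieAlgType K).
Implicit Types (x y z : g) (U V W : {vspace g}).

HB.instance Definition _ :=
  bilinear_isBilinear.Build K g g g *:%R *:%R (@lie K g) lie_bilinear.

HB.instance Definition _ x :=
  GRing.isLinear.Build K g g *:%R (lie x) (lie_bilinear.2 x).

Definition ad x : 'End(g) := linfun (lie x).

Lemma adE x y : ad x y = [lie x, y].
Proof. by rewrite /ad lfunE. Qed.

Lemma ad_is_linear : linear ad.
Proof.
move=> a x y; apply/lfunP => z.
by rewrite add_lfunE scale_lfunE !adE linearPl.
Qed.
HB.instance Definition _ :=
  GRing.isLinear.Build K g 'End(g) *:%R ad ad_is_linear.

Definition lie_center : {vspace g} := lker (linfun ad).

Lemma mem_lie_center z :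
  reflect (forall x, [lie z, x] = 0) (z \in lie_center).
Proof.
rewrite memv_ker lfunE /=.
apply: (iffP eqP) => [z0 x|z0]; first by rewrite -adE z0 lfunE.
by apply/lfunP => x; rewrite adE z0 lfunE.
Qed.

Definition liev U V : {vspace g} :=
  <<[seq [lie u, v] | u <- vbasis U, v <- vbasis V]>>%VS.

Lemma memv_lie U V : {in U & V, forall u v, [lie u, v] \in liev U V}.
Proof.
move=> u v /coord_vbasis-> /coord_vbasis->.
rewrite linear_sumlz; apply: memv_suml => i _.
rewrite linear_sumr; apply: memv_suml => j _.
rewrite linearZl_LR linearZr_LR /= !memvZ // memv_span //.
by apply/allpairsP; exists ((vbasis U)`_i, (vbasis V)`_j);
  rewrite !mem_nth ?size_tuple.
Qed.

Lemma lievP U V W :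
  reflect {in U & V, forall u v, [lie u, v] \in W} (liev U V <= W)%VS.
Proof.
apply: (iffP idP) => [/subvP sUVW u v uU vV|UVW].
  by apply: sUVW; exact: memv_lie.
apply/span_subvP => _ /allpairsP[[u v] /= [uU vV ->]].
by apply: UVW; exact: vbasis_mem.
Qed.

Definition two_step_nilpotent : Prop :=
  liev fullv (liev fullv fullv) = 0%VS /\ liev fullv fullv != 0%VS.

(* In a 2-step nilpotent Lie algebra ad x takes its values in the center, so
   this equality is the surjectivity of ad x onto the center. *)
Definition non_singular : Prop :=
  forall x, x \notin lie_center -> limg (ad x) = lie_center.

Definition ad_invariant (B : {symmetric g}) : Prop :=
  forall x y z, B [lie x, y] z + B y [lie x, z] = 0.

Definition admits_ad_invariant_metric : Prop :=
  exists B : {symmetric g}, nondegenerate B /\ ad_invariant B.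

End LieAlgebraTheory.

Arguments lie_center {K} g.
Arguments two_step_nilpotent {K} g.
Arguments non_singular {K} g.
Arguments admits_ad_invariant_metric {K} g.

Section HType.
Variables (R : realType) (n : lieAlgType R) (ip : {dot n for idfun}).

Definition hcompl : {vspace n} := orthov ip (lie_center n).
Local Notation v := (subvs_of hcompl).

Let ipPr x a y z : ip x (a *: y + z) = a * ip x y + ip x z.
Proof. exact: linearPr. Qed.

Let ipPl a x y z : ip (a *: x + y) z = a * ip x z + ip y z.
Proof. exact: linearPl. Qed.

(* For z in n and u in v, [omega z u] is the linear form w |-> (z, [u, w])
   on v; [flat u] is w |-> (u, w), and J_z u is the vector that [flat]
   maps to [omega z u]. *)
Definition flat (u : v) : 'Hom(v, R^o) :=
  linfun (fun w : v => ip (vsval u) (vsval w) : R^o).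

Definition omega (z : n) (u : v) : 'Hom(v, R^o) :=
  linfun (fun w : v => ip z [lie vsval u, vsval w] : R^o).

Definition J (z : n) : 'End(v) := ((linfun flat)^-1 \o linfun (omega z))%VF.

Lemma flatE u w : flat u w = ip (vsval u) (vsval w).
Proof.
pose f (w : v) := ip (vsval u) (vsval w) : R^o.
have fl : linear f by move=> a x y; rewrite /f linearP.
pose F := GRing.isLinear.Build R v R^o *:%R f fl.
pose f' : {linear v -> R^o} := HB.pack f F.
exact: (lfunE f').
Qed.

Lemma omegaE z u w : omega z u w = ip z [lie vsval u, vsval w].
Proof.
pose f (w : v) := ip z [lie vsval u, vsval w] : R^o.
have fl : linear f by move=> a x y; rewrite /f !linearP.
pose F := GRing.isLinear.Build R v R^o *:%R f fl.
pose f' : {linear v -> R^o} := HB.pack f F.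
exact: (lfunE f').
Qed.

Lemma flat_is_linear : linear flat.
Proof.
move=> a x y; apply/lfunP => w.
by rewrite add_lfunE scale_lfunE !flatE linearP /= ipPl.
Qed.
HB.instance Definition _ :=
  GRing.isLinear.Build R v 'Hom(v, R^o) *:%R flat flat_is_linear.

Lemma omega_is_linear z : linear (omega z).
Proof.
move=> a x y; apply/lfunP => w.
by rewrite add_lfunE scale_lfunE !omegaE linearP /= linearPl ipPr.
Qed.
HB.instance Definition _ z :=
  GRing.isLinear.Build R v 'Hom(v, R^o) *:%R (omega z) (omega_is_linear z).

Lemma flat_inj : injective flat.
Proof.
move=> x y xy.
have xy0 : ip (vsval (x - y)) (vsval (x - y)) = 0.
  by rewrite -flatE [flat (x - y)]linearB /= xy subrr zero_lfunE.
apply/eqP; rewrite -subr_eq0; apply/contraT => xyN0.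
have := @neq0_dnorm_gt0 _ _ _ ip (vsval (x - y)).
by rewrite xy0 ltxx => /(_ xyN0).
Qed.

Lemma limg_flat : limg (linfun flat) = fullv.
Proof.
apply/eqP; rewrite eqEdim subvf /= limg_dim_eq ?dimvf /dim /= ?muln1 //.
have /lker0P/eqP-> : injective (linfun flat).
  by move=> x y; rewrite !lfunE => /flat_inj.
by rewrite capv0.
Qed.

Lemma J_spec z (u w : v) :
  ip (vsval (J z u)) (vsval w) = ip z [lie vsval u, vsval w].
Proof.
rewrite -flatE -omegaE; suff -> : flat (J z u) = omega z u by [].
have := @limg_lfunVK _ _ _ (linfun flat) (omega z u).
by rewrite limg_flat memvf !lfunE /= !lfunE => ->.
Qed.

Lemma J_unique z (j : 'End(v)) :
  (forall u w : v, ip (vsval (j u)) (vsval w) = ip z [lie vsval u, vsval w]) ->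
  j = J z.
Proof.
move=> jP; apply/lfunP => u; apply: flat_inj; apply/lfunP => w.
by rewrite !flatE jP J_spec.
Qed.

Definition H_type : Prop :=
  forall z, z \in lie_center n -> (J z \o J z)%VF = - ip z z *: \1%VF.

End HType.

(* Main.v *)
(* An ad-invariant metric B satisfies B([x, y], x) = - B(y, [x, x]) = 0, so
   every non-central x is orthogonal to the image of ad x, which is the center
   z by non-singularity.  A central vector is a difference of two non-central
   ones, so z is orthogonal to everything, hence z = 0 by non-degeneracy; but
   z contains [n, n].
   If n is of H-type and u is a nonzero vector of v = z^_|_, polarizing
   |J_z u|^2 = |z|^2 |u|^2 gives (z', [u, J_z u]) = (z', z) |u|^2, that is
   [u, J_z u] = |u|^2 z.  Hence ad u is onto z and n is non singular. *)
Require Import Defs.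
From mathcomp Require Import all_boot all_order all_algebra.
From mathcomp Require Import reals lra.

Import Order.TTheory GRing.Theory Num.Theory.

Local Open Scope ring_scope.

Section NonSingular.
Variables (K : fieldType) (n : lieAlgType K).

Lemma lieC (x y : n) : [lie x, y] = - [lie y, x].
Proof.
have := lie_alternating (x + y).
rewrite linearDr /= !linearDl /= !lie_alternating add0r addr0.
by move=> /eqP; rewrite addr_eq0 => /eqP ->; rewrite opprK.
Qed.

Lemma two_step_lie_center (x y : n) :
  two_step_nilpotent n -> [lie x, y] \in lie_center n.
Proof.
move=> [n2 _]; apply/mem_lie_center => w; rewrite lieC.
suff : [lie w, [lie x, y]] \in 0%VS by rewrite memv0 => /eqP ->; rewrite oppr0.
by rewrite -n2 !memv_lie ?memvf.
Qed.

Lemma two_step_nonabelian :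
  two_step_nilpotent n -> exists x y : n, [lie x, y] != 0.
Proof.
case=> _ nz.
(* Searching only pairs of basis vectors makes the existence decidable, so it can be proved by
   contraposition. *)
suff /hasP[x _ /hasP[y _ xy0]] :
    has (fun x => has (fun y => [lie x, y] != 0) (vbasis (fullv : {vspace n})))
      (vbasis (fullv : {vspace n})) by exists x, y.
apply: contraNT nz => /hasPn all0; rewrite -subv0; apply/span_subvP => w.
case/allpairsP=> -[x y] /= [xb yb ->].
by have /hasPn/(_ y yb) := all0 x xb; rewrite negbK memv0.
Qed.

Lemma non_singular_no_ad_invariant_metric :
  two_step_nilpotent n -> non_singular n -> ~ admits_ad_invariant_metric n.
Proof.
move=> n2 ns [B [/eqP ndB Binv]].
have [x [y xy0]] := two_step_nonabelian n2.
have Bnc (a c : n) :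
    a \notin lie_center n -> c \in lie_center n -> B c a = 0.
  move=> /ns <- /memv_imgP[b _ ->]; rewrite adE.
  by have := Binv a b a; rewrite lie_alternating linear0r addr0.
have xnc : x \notin lie_center n.
  by apply: contra xy0 => /mem_lie_center/(_ y) ->.
suff : [lie x, y] \in orthov B fullv by rewrite ndB memv0 (negPf xy0).
apply/mem_orthovP => a _.
have cxy := two_step_lie_center x y n2.
have [ac|/Bnc-> //] := boolP (a \in lie_center n).
(* For central [a], write [a = (x + a) - x] with [x + a] and [x] both non-central. *)
have : B [lie x, y] (x + a) = 0 by apply: Bnc; rewrite ?rpredDr.
by rewrite linearDr /= Bnc // add0r.
Qed.

End NonSingular.

Section InnerProduct.
Variables (R : realFieldType) (V : vectType R) (ip : {dot V for idfun}).

Lemma dot_sym (x y : V) : ip x y = ip y x.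
Proof. by rewrite hermC expr0 mul1r. Qed.

Lemma dot_eq0 (x : V) : (ip x x == 0) = (x == 0).
Proof.
have [->|x0] := eqVneq x 0; first by rewrite linear0l eqxx.
by apply/negbTE; rewrite gt_eqF // neq0_dnorm_gt0.
Qed.

(** Gram-Schmidt, by induction on a list spanning [W]. *)
Lemma orthogonal_projection (W : {vspace V}) (x : V) :
  exists2 w, w \in W & x - w \in orthov ip W.
Proof.
suff proj (s : seq V) : forall y,
    exists2 w, w \in <<s>>%VS & y - w \in orthov ip <<s>>.
  by have := proj (vbasis W) x; rewrite (span_basis (vbasisP W)).
elim: s => [|a s IHs] y.
  by exists 0; rewrite ?span_nil ?mem0v ?orthov0 ?memvf.
have [b bs ab] := IHs a; have [c cs yc] := IHs y.
have [c' c's [yc's yc'a]] : exists2 c', c' \in <<a :: s>>%VS &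
    y - c' \in orthov ip <<s>> /\ ip (y - c') (a - b) = 0.
  (* [a - b] is the part of [a] orthogonal to [<<s>>]. If it vanishes, [a] adds nothing to the span
     and [c] still works; otherwise [c] is corrected along [a - b], which keeps orthogonality to
     [<<s>>]. *)
  have [ab0|ab0] := eqVneq (a - b) 0.
    exists c; last by rewrite ab0 linear0r.
    by rewrite span_cons -[c]add0r memv_add ?mem0v.
  pose k := ip (y - c) (a - b) / ip (a - b) (a - b).
  exists (c + k *: (a - b)).
    rewrite span_cons scalerBr addrCA memv_add ?memvZ ?memv_line //.
    by rewrite rpredB ?memvZ.
  rewrite opprD addrA; split; first by rewrite rpredB ?memvZ.
  by rewrite linearBl /= linearZl_LR /= divfK ?subrr // dot_eq0.
exists c' => //; apply/mem_orthovP => w.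
rewrite span_cons => /memv_addP[_ /vlineP[k ->] [v vs ->]].
move/mem_orthovP: yc's => yc's.
have yc'0 : ip (y - c') a = 0.
  by rewrite -(subrK b a) linearDr /= yc'a yc's ?addr0.
by rewrite linearDr /= linearZr_LR /= yc'0 mulr0 yc's ?addr0.
Qed.

End InnerProduct.

Section HType.
Variables (R : realType) (n : lieAlgType R) (ip : {dot n for idfun}).
Local Notation v := (subvs_of (hcompl ip)).

Lemma J_indexD (z z' : n) (u : v) :
  J ip (z + z') u = J ip z u + J ip z' u.
Proof.
apply: (@flat_inj _ _ ip); apply/lfunP => w; rewrite !flatE.
by rewrite linearD /= linearDl /= !J_spec linearDl.
Qed.

(** Inherited from the antisymmetry of the bracket. *)
Lemma J_skew (z : n) (u w : v) :
  ip (vsval (J ip z u)) (vsval w) = - ip (vsval u) (vsval (J ip z w)).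
Proof. by rewrite [ip (vsval u) _]dot_sym !J_spec [in LHS]lieC linearNr. Qed.

Hypothesis n2 : two_step_nilpotent n.
Hypothesis nH : H_type ip.

(** Skew-symmetry moves one [J ip z] across, producing [J_z^2 = - (z, z)]. *)
Lemma H_type_dot (z : n) (u : v) : z \in lie_center n ->
  ip (vsval (J ip z u)) (vsval (J ip z u)) = ip z z * ip (vsval u) (vsval u).
Proof.
move=> zc; rewrite J_skew.
have /lfunP/(_ u) := nH z zc; rewrite comp_lfunE scale_lfunE id_lfunE => ->.
by rewrite linearZ /= mulNr opprK.
Qed.

(** Polarization: compare the cross terms of the norm identity at [z + z']. *)
Lemma H_type_dot2 (z z' : n) (u : v) :
  z \in lie_center n -> z' \in lie_center n ->
  ip (vsval (J ip z u)) (vsval (J ip z' u)) = ip z z' * ip (vsval u) (vsval u).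
Proof.
move=> zc z'c; have := H_type_dot _ u (rpredD zc z'c).
rewrite J_indexD linearD /= !(linearDr, linearDl) /=.
rewrite !H_type_dot //.
set a : n := vsval (J _ z _); set b : n := vsval (J _ z' _).
rewrite [ip z' z]dot_sym [ip b a]dot_sym; lra.
Qed.

Lemma H_type_lie (z : n) (u : v) : z \in lie_center n ->
  [lie vsval u, vsval (J ip z u)] = ip (vsval u) (vsval u) *: z.
Proof.
move=> zc; set d := [lie _, _]; set k := ip _ _.
have dc : d - k *: z \in lie_center n.
  by rewrite rpredB ?memvZ // two_step_lie_center.
(* With [e = d - k *: z] central, [(e, d) = (J_e u, J_z u) = (e, z) k = (e, k z)], so
   [(e, e) = 0]. *)
apply/eqP; rewrite -subr_eq0 -(dot_eq0 _ _ ip) linearBr /= linearZr_LR /=.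
by rewrite -J_spec H_type_dot2 // mulrC subrr.
Qed.

Lemma H_type_non_singular : non_singular n.
Proof.
move=> x xnc; apply/eqP; rewrite eqEsubv; apply/andP; split; apply/subvP => z.
  by case/memv_imgP=> y _ ->; rewrite adE two_step_lie_center.
move=> zc; have [c cc xcv] := orthogonal_projection _ _ ip (lie_center n) x.
pose u : v := Subvs xcv; pose k := ip (vsval u) (vsval u).
(* If [u] were zero, [x] would equal the central vector [c]. *)
have k0 : k != 0.
  rewrite dot_eq0 /= subr_eq0; apply: contraNneq xnc => ->; exact: cc.
(* Since [c] is central, [ad x] and [ad u] agree, and [[u, J_z u] = k z] gives the preimage of
   [z]. *)
apply/memv_imgP; exists (k^-1 *: vsval (J ip z u)); first exact: memvf.
have -> : x = c + vsval u by rewrite /= addrC subrK.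
rewrite adE linearZr_LR /= linearDl /= (mem_lie_center _ cc) add0r.
by rewrite (H_type_lie _ u zc) scalerA mulVf ?scale1r.
Qed.

End HType.

Theorem corollary5p1 (R : realType) :
  (forall n : lieAlgType R, two_step_nilpotent n -> non_singular n ->
     ~ admits_ad_invariant_metric n) /\
  (forall (n : lieAlgType R) (ip : {dot n for idfun}),
     two_step_nilpotent n -> H_type ip -> ~ admits_ad_invariant_metric n).
Proof.
split=> [n|n ip n2 nH]; first exact: non_singular_no_ad_invariant_metric.
apply: non_singular_no_ad_invariant_metric => //.
exact: H_type_non_singular nH.
Qed.
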